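(* Let $A,B\in\mathbb{C}^{N\times N}$ be commuting matrices such that $A+sI$ and $B+sI$ are invertible for every integer $s\ge0$. Then for every integer $n\ge3$ the Bateman matrix polynomials satisfy $$(A+nI)(B+nI)\mathbf{B}_n^{A,B}(z)=\left(3n^2I+(2A+2B-3I)n+(A-I)(B-I)-zI\right)\mathbf{B}_{n-1}^{A,B}(z)-(n-1)\left(A+B+(3n-3)I\right)\mathbf{B}_{n-2}^{A,B}(z)+(n-1)(n-2)\mathbf{B}_{n-3}^{A,B}(z).$$
   Context: $I$ is the $N\times N$ identity matrix; for $M\in\mathbb{C}^{N\times N}$, $(M)_0=I$ and $(M)_k=M(M+I)\cdots(M+(k-1)I)$ for $k\ge1$. The Bateman matrix polynomials are $$\mathbf{B}_n^{A,B}(z)=\sum_{k=0}^{n}\frac{(-1)^k n!\,z^k}{k!\,(n-k)!}[(A+I)_k]^{-1}[(B+I)_k]^{-1}.$$ *)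

(* Defs.v *)
From mathcomp Require Import all_boot all_order all_algebra.

Set Implicit Arguments.
Unset Strict Implicit.
Unset Printing Implicit Defensive.

Import GRing.Theory Num.Theory.
Local Open Scope ring_scope.

Definition mx_pochhammer (F : fieldType) (N : nat) (M : 'M[F]_N) (k : nat) :
    'M[F]_N :=
  \big[mulmx/1%:M]_(i < k) (M + i%:R%:M).

(* The factorial quotient is the intended one only in characteristic 0.
   invmx is the identity on singular matrices, so the definition is meaningful
   only when A + s I and B + s I are invertible for all s >= 1. *)
Definition bateman (F : fieldType) (N : nat) (A B : 'M[F]_N) (n : nat) (z : F) :
    'M[F]_N :=
  \sum_(k < n.+1)
    ((-1) ^+ k * n`!%:R * z ^+ k / (k`!%:R * (n - k)`!%:R))
      *: (invmx (mx_pochhammer (A + 1%:M) k)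
          *m invmx (mx_pochhammer (B + 1%:M) k)).

(* Main.v *)
Require Import Defs.
From mathcomp Require Import all_boot all_order all_algebra.
From mathcomp Require Import complex reals.
From mathcomp Require Import ring.

(** Write D_k for the inverse of (A+I)_k (B+I)_k.  Since the factorial quotient
    in the definition is a binomial coefficient, the polynomial of index n is
    the sum of (-z)^k C(n,k) D_k, and the sum may be prolonged beyond n.  The
    only relation between the D_k that matters is
    D_k = (A+(k+1)I) (B+(k+1)I) D_(k+1); it uses that A and B commute, and it
    turns multiplication by -z into a shift of the index k
    ([scale_bateman_shift]).

    All terms of the recurrence are then sums over the same range, and it is
    enough to compare the factors of (-z)^k D_k.  They are combinations of AB,
    A, B and I with scalar coefficients in C(n,k), ..., C(n-3,k), so a scalar
    identity is needed for each of these four matrices.  For k close to n the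
    lower binomials vanish, so quotients of successive ones are avoided: they
    are reduced to one another by m C(m-1,k) = (m-k) C(m,k), which holds for
    every k ([bateman_term_rec]). *)

Set Implicit Arguments.
Unset Strict Implicit.
Unset Printing Implicit Defensive.

Import GRing.Theory Num.Theory.
Local Open Scope ring_scope.
Local Open Scope complex_scope.

Lemma comm_mx_invmx (F : fieldType) (N : nat) (X Y : 'M[F]_N) :
  Y \in unitmx -> comm_mx X Y -> comm_mx X (invmx Y).
Proof.
move=> uY cXY; rewrite /comm_mx -[LHS](mulKmx uY) [Y *m _]mulmxA -cXY.
by rewrite mulmxK.
Qed.

Lemma mx_pochhammerS (F : fieldType) (N : nat) (M : 'M[F]_N) (k : nat) :
  mx_pochhammer M k.+1 = mx_pochhammer M k *m (M + k%:R%:M).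
Proof.
(* Splitting off the last factor needs a monoid law, which square matrices
   carry under their ring multiplication. *)
exact: (big_ord_recr k (op := ( *%R : 'M[F]_N -> _))).
Qed.

Lemma mx_pochhammer_shiftS (F : fieldType) (N : nat) (M : 'M[F]_N) (k : nat) :
  mx_pochhammer (M + 1%:M) k.+1
    = mx_pochhammer (M + 1%:M) k *m (M + k.+1%:R%:M).
Proof. by rewrite mx_pochhammerS -addrA -raddfD -mulrS. Qed.

Lemma comm_mx_pochhammer (F : fieldType) (N : nat) (X M : 'M[F]_N) (k : nat) :
  comm_mx X M -> comm_mx X (mx_pochhammer M k).
Proof.
move=> cXM; elim: k => [|k IHk].
  by rewrite /mx_pochhammer big_ord0; apply: comm_mx_scalar.
rewrite mx_pochhammerS; apply: comm_mxM => //.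
by apply: comm_mxD => //; apply: comm_mx_scalar.
Qed.

Lemma mx_pochhammer_unit (F : fieldType) (N : nat) (M : 'M[F]_N) (k : nat) :
  (forall s : nat, M + s%:R%:M \in unitmx) ->
  mx_pochhammer (M + 1%:M) k \in unitmx.
Proof.
move=> uM; elim: k => [|k IHk].
  by rewrite /mx_pochhammer big_ord0 unitmx1.
by rewrite mx_pochhammer_shiftS unitmx_mul IHk uM.
Qed.

Lemma invmx_mx_pochhammer (F : fieldType) (N : nat) (M : 'M[F]_N) (k : nat) :
  (forall s : nat, M + s%:R%:M \in unitmx) ->
  (M + k.+1%:R%:M) *m invmx (mx_pochhammer (M + 1%:M) k.+1)
    = invmx (mx_pochhammer (M + 1%:M) k).
Proof.
move=> uM; have uP j := mx_pochhammer_unit j uM.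
rewrite -[LHS](mulKmx (uP k)) [X in _ *m X]mulmxA -mx_pochhammer_shiftS.
by rewrite mulmxV ?uP ?mulmx1.
Qed.

Definition bateman_coef (F : fieldType) (N : nat) (A B : 'M[F]_N) (k : nat) :
    'M[F]_N :=
  invmx (mx_pochhammer (A + 1%:M) k) *m invmx (mx_pochhammer (B + 1%:M) k).

(** Commutativity is needed exactly here: B + (k+1) I has to pass the inverse
    Pochhammer symbol of A to cancel the last factor of that of B. *)
Lemma bateman_coefS (F : fieldType) (N : nat) (A B : 'M[F]_N) (k : nat) :
  A *m B = B *m A ->
  (forall s : nat, A + s%:R%:M \in unitmx) ->
  (forall s : nat, B + s%:R%:M \in unitmx) ->
  (A + k.+1%:R%:M) *m (B + k.+1%:R%:M) *m bateman_coef A B k.+1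
    = bateman_coef A B k.
Proof.
move=> cAB uA uB; rewrite /bateman_coef.
have cBP : comm_mx (B + k.+1%:R%:M) (invmx (mx_pochhammer (A + 1%:M) k.+1)).
  apply: comm_mx_invmx; first exact: mx_pochhammer_unit.
  apply/comm_mx_pochhammer/comm_mx_sym.
  apply: comm_mxD; last exact: comm_mx_scalar.
  by apply: comm_mx_sym; apply: comm_mxD; [exact/esym | exact: comm_mx_scalar].
rewrite -mulmxA [X in _ *m X]mulmxA cBP -!mulmxA invmx_mx_pochhammer //.
by rewrite mulmxA invmx_mx_pochhammer.
Qed.

(** The range may exceed the degree, since the binomials vanish there; this
    lets polynomials of different indices be compared term by term. *)
Lemma bateman_bin (F : numFieldType) (N : nat) (A B : 'M[F]_N) (z : F)
    (m n : nat) : (m <= n)%N ->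
  bateman A B m z
    = \sum_(k < n.+1) ((- z) ^+ k * 'C(m, k)%:R) *: bateman_coef A B k.
Proof.
move=> lemn.
rewrite /bateman (big_ord_widen n.+1 (fun k =>
  ((-1) ^+ k * m`!%:R * z ^+ k / (k`!%:R * (m - k)`!%:R))
    *: bateman_coef A B k)) //.
rewrite big_mkcond; apply: eq_bigr => k _ /=.
rewrite ltnS; case: leqP => [lekm|ltmk]; last first.
  by rewrite bin_small // mulr0 scale0r.
have fne j : j`!%:R != 0 :> F by rewrite pnatr_eq0 -lt0n fact_gt0.
congr (_ *: _); rewrite -(bin_fact lekm) !natrM [(- z) ^+ k]exprNn.
by field; rewrite !fne.
Qed.

(** The shifted binomial C(m,k-1) is written C(m+1,k) - C(m,k): this vanishes
    at k = 0, where truncated subtraction would not give C(m,-1) = 0. *)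
Lemma scale_bateman_shift (F : numFieldType) (N : nat) (A B : 'M[F]_N) (z : F)
    (m : nat) :
  A *m B = B *m A ->
  (forall s : nat, A + s%:R%:M \in unitmx) ->
  (forall s : nat, B + s%:R%:M \in unitmx) ->
  - z *: bateman A B m z
    = \sum_(k < m.+2) ((- z) ^+ k * ('C(m.+1, k)%:R - 'C(m, k)%:R))
        *: ((A + k%:R%:M) *m (B + k%:R%:M) *m bateman_coef A B k).
Proof.
move=> cAB uA uB; rewrite big_ord_recl /= !bin0 subrr mulr0 scale0r add0r.
rewrite (bateman_bin A B z (leqnn m)) scaler_sumr; apply: eq_bigr => k _.
rewrite scalerA mulrA -exprS bateman_coefS // binS natrD.
by rewrite [_ + 'C(m, k)%:R]addrC addrK.
Qed.

(** No condition on k: both sides vanish when k > m + 1. *)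
Lemma natr_bin_down (R : comPzRingType) (m k : nat) :
  m.+1%:R * 'C(m, k)%:R = (m.+1%:R - k%:R) * 'C(m.+1, k)%:R :> R.
Proof.
rewrite -natrM (mul_bin_down m.+1); case: (leqP k m.+1) => [lekm|ltmk].
  by rewrite natrM natrB.
by rewrite bin_small // muln0 mulr0.
Qed.

(** The comparison of the factors of (-z)^k D_k.  The summand with
    C(n,k) - C(n-1,k) is the one produced by the shift. *)
Lemma bateman_term_rec (F : fieldType) (N : nat) (A B D : 'M[F]_N)
    (m k : nat) (n := m.+3) :
  'C(n, k)%:R *: ((A + n%:R%:M) *m (B + n%:R%:M) *m D) =
    'C(m.+2, k)%:R *: (((3 * n%:R ^+ 2)%:M + n%:R *: (2 *: A + 2 *: B - 3%:M)
       + (A - 1%:M) *m (B - 1%:M)) *m D)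
    + ('C(n, k)%:R - 'C(m.+2, k)%:R) *: ((A + k%:R%:M) *m (B + k%:R%:M) *m D)
    - (n%:R - 1) *: ('C(m.+1, k)%:R *: ((A + B + (3 * n%:R - 3)%:M) *m D))
    + (n%:R - 1) *: ((n%:R - 2) *: ('C(m, k)%:R *: D)).
Proof.
have := (natr_bin_down F m.+2 k, natr_bin_down F m.+1 k, natr_bin_down F m k).
rewrite -/n.
move: ('C(n, k)%:R) ('C(m.+2, k)%:R) ('C(m.+1, k)%:R) ('C(m, k)%:R).
have -> : m.+2%:R = n%:R - 1 :> F by rewrite -[n]addn1 natrD addrK.
have -> : m.+1%:R = n%:R - 2 :> F by rewrite -[n](addn2 m.+1) natrD addrK.
move: (n%:R) (k%:R) => {m n}n {}k x y u v [[Ey Eu] Ev].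
have mulZl (c : F) (X Y : 'M[F]_N) : (c *: X) *m Y = c *: (X *m Y).
  by rewrite -scalemxAl.
rewrite !(mulmxDl, mulmxDr, mulNmx, mulmxN, mulZl,
  mul_scalar_mx, mul_mx_scalar).
move: (A *m B *m D) (A *m D) (B *m D) => ABD AD BD.
apply/matrixP => i j; rewrite !mxE.
move: (ABD i j) (AD i j) (BD i j) (D i j) => p a b d.
(* The difference of the two sides is a combination of the three relations;
   its multipliers come from eliminating v, then u, then y. *)
have Ey0 : n * y - (n - k) * x = 0 by rewrite Ey subrr.
have Eu0 : (n - 1) * u - (n - 1 - k) * y = 0 by rewrite Eu subrr.
have Ev0 : (n - 2) * v - (n - 2 - k) * u = 0 by rewrite Ev subrr.
apply/eqP; rewrite -subr_eq0; apply/eqP.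
transitivity (- (n * y - (n - k) * x) * (a + b + (n + k) * d)
  + ((n - 1) * u - (n - 1 - k) * y) * (a + b + (2 * n - 1 + k) * d)
  - ((n - 2) * v - (n - 2 - k) * u) * (n - 1) * d).
  by ring.
by rewrite Ey0 Eu0 Ev0 oppr0 !mul0r addr0 oppr0 addr0.
Qed.

Theorem theorem4p9 (R : realType) (N : nat) (A B : 'M[R[i]]_N)
  (hAB : A *m B = B *m A)
  (hA : forall s : nat, A + s%:R%:M \in unitmx)
  (hB : forall s : nat, B + s%:R%:M \in unitmx)
  (n : nat) (hn : (3 <= n)%N) (z : R[i]) :
  (A + n%:R%:M) *m (B + n%:R%:M) *m bateman A B n z =
    ((3 * n%:R ^+ 2)%:M + n%:R *: (2 *: A + 2 *: B - 3%:M)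
       + (A - 1%:M) *m (B - 1%:M) - z%:M) *m bateman A B (n - 1) z
    - (n%:R - 1) *: ((A + B + (3 * n%:R - 3)%:M) *m bateman A B (n - 2) z)
    + ((n%:R - 1) * (n%:R - 2)) *: bateman A B (n - 3) z.
Proof.
case: n hn => [|[|[|m]]] // _.
have -> : (m.+3 - 1 = m.+2)%N by rewrite subn1.
have -> : (m.+3 - 2 = m.+1)%N by rewrite subn2.
have -> : (m.+3 - 3 = m)%N by rewrite subSS subSS subn1.
rewrite mulmxBl mul_scalar_mx -scaleNr (scale_bateman_shift z m.+2 hAB hA hB).
(* All sums run over k <= n, the range of the shifted sum of index n - 1. *)
have le1 := leqnSn m.+2; have le2 := leq_trans (leqnSn m.+1) le1.
have le3 := leq_trans (leqnSn m) le2.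
rewrite (bateman_bin A B z (leqnn m.+3)) (bateman_bin A B z le1).
rewrite (bateman_bin A B z le2) (bateman_bin A B z le3).
rewrite !mulmx_sumr !scaler_sumr -big_split /= -sumrB -big_split /=.
apply: eq_bigr => k _; rewrite -!scalemxAr -!scalerA bateman_term_rec.
move: ((- z) ^+ k) => w.
have scaleAC (a : R[i]) (X : 'M[R[i]]_N) : a *: (w *: X) = w *: (a *: X).
  by rewrite !scalerA mulrC.
rewrite [X in _ = _ - X + _]scaleAC [X in _ = _ + _ *: X]scaleAC.
rewrite [X in _ = _ + X]scaleAC.
by rewrite scalerDr scalerBr scalerDr.
Qed.
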